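(* Let $\rho:G\to \mathrm{GL}_2(\mathbb{C})$ be an irreducible 2-dimensional representation of a finite group $G$, and let $\overline{G}$ be its projective image in $\mathrm{PGL}_2(\mathbb{C})$. Then $\mathrm{Ad}(\rho)$ is irreducible if and only if $\overline{G}\cong A_4$, $S_4$ or $A_5$.
   Context: The projective image $\overline G$ is the image of $\rho(G)$ under the natural projection $\mathrm{GL}_2(\mathbb{C})\to\mathrm{PGL}_2(\mathbb{C})$. The adjoint $\mathrm{Ad}(\rho)$ is the 3-dimensional representation of $G$ on the space of trace-zero $2\times 2$ complex matrices given by $g\cdot M=\rho(g)M\rho(g)^{-1}$. $A_n$ and $S_n$ denote alternating and symmetric groups. *)

(* Defs.v *)
From HB Require Import structures.
From mathcomp Require Import all_boot all_order all_algebra all_fingroup.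
From mathcomp Require Import all_solvable all_character.
From mathcomp Require Import ring.
From mathcomp Require Export reals complex.

Set Implicit Arguments.
Unset Strict Implicit.
Unset Printing Implicit Defensive.

Import GRing.Theory.
Local Open Scope ring_scope.
Local Open Scope quotient_scope.

(* The library's {'GL_n[R]} is restricted to finite R. *)
Definition GL (F : fieldType) (n : nat) : Type :=
  {A : 'M[F]_n | A \in unitmx}.

Section GeneralLinear.
Variables (F : fieldType) (n : nat).
Implicit Types A B C : GL F n.

HB.instance Definition _ := Choice.on (GL F n).

Fact GL_one_subproof : (1%:M : 'M[F]_n) \in unitmx.
Proof. exact: unitmx1. Qed.
Fact GL_inv_subproof A : invmx (val A) \in unitmx.
Proof. by rewrite unitmx_inv (valP A). Qed.
Fact GL_mul_subproof A B : val A *m val B \in unitmx.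
Proof. by rewrite unitmx_mul !(valP A, valP B). Qed.

Definition GL_one : GL F n := Sub 1%:M GL_one_subproof.
Definition GL_inv A : GL F n := Sub (invmx (val A)) (GL_inv_subproof A).
Definition GL_mul A B : GL F n := Sub (val A *m val B) (GL_mul_subproof A B).

Fact GL_mulA : associative GL_mul.
Proof. by move=> A B C; apply: val_inj; rewrite /= mulmxA. Qed.
Fact GL_mul1 : left_id GL_one GL_mul.
Proof. by move=> A; apply: val_inj; rewrite /= mul1mx. Qed.
Fact GL_mulr1 : right_id GL_one GL_mul.
Proof. by move=> A; apply: val_inj; rewrite /= mulmx1. Qed.
Fact GL_mulV : left_inverse GL_one GL_inv GL_mul.
Proof. by move=> A; apply: val_inj; rewrite /= mulVmx ?(valP A). Qed.
Fact GL_mulrV : right_inverse GL_one GL_inv GL_mul.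
Proof. by move=> A; apply: val_inj; rewrite /= mulmxV ?(valP A). Qed.

HB.instance Definition _ :=
  isGroup.Build (GL F n) GL_mulA GL_mul1 GL_mulr1 GL_mulV GL_mulrV.

Lemma val_GL1 : val (1%g : GL F n) = 1%:M. Proof. by []. Qed.
Lemma val_GLM A B : val (A * B)%g = val A *m val B. Proof. by []. Qed.
Lemma val_GLV A : val (A^-1)%g = invmx (val A). Proof. by []. Qed.

Definition proj_equiv A B : bool := is_scalar_mx (val (A * B^-1)%g).

Lemma proj_equivP A B :
  reflect (exists2 c : F, c != 0 & val A = c *: val B) (proj_equiv A B).
Proof.
apply: (iffP idP) => [/is_scalar_mxP [c defc] | [c _ defA]]; last first.
  apply/is_scalar_mxP; exists c.
  by rewrite val_GLM val_GLV defA -scalemxAl mulmxV ?(valP B) // scalemx1.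
have defA : val A = c *: val B.
  by rewrite -mul_scalar_mx -defc val_GLM val_GLV mulmxKV ?(valP B).
have [c0 | nzc] := eqVneq c 0; last by exists c.
exists 1; first exact: oner_neq0.
have A0 : val A = 0 by rewrite defA c0 scale0r.
have I0 : (1%:M : 'M[F]_n) = 0 by rewrite -(mulmxV (valP A)) A0 mul0mx.
by rewrite -[LHS]mul1mx -[val B]mul1mx I0 !mul0mx scaler0.
Qed.

Fact proj_equiv_refl : reflexive proj_equiv.
Proof. by move=> A; apply/proj_equivP; exists 1; rewrite ?oner_neq0 ?scale1r. Qed.
Fact proj_equiv_sym : symmetric proj_equiv.
Proof.
suff s A B : proj_equiv A B -> proj_equiv B A.
  by move=> A B; apply/idP/idP; apply: s.
case/proj_equivP=> c nzc defA; apply/proj_equivP; exists c^-1.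
  by rewrite invr_eq0.
by rewrite defA scalerA mulVf ?scale1r.
Qed.
Fact proj_equiv_trans : transitive proj_equiv.
Proof.
move=> B A C /proj_equivP[c nzc defA] /proj_equivP[d nzd defB].
by apply/proj_equivP; exists (c * d); rewrite ?mulf_neq0 // defA defB scalerA.
Qed.

Canonical proj_equiv_rel :=
  EquivRel proj_equiv proj_equiv_refl proj_equiv_sym proj_equiv_trans.

Definition PGL : Type := {eq_quot proj_equiv}.
HB.instance Definition _ := Choice.on PGL.
HB.instance Definition _ := EqQuotient.on PGL.

Definition to_PGL A : PGL := \pi_PGL A.

Lemma to_PGL_eq A B :
  to_PGL A = to_PGL B <-> exists2 c : F, c != 0 & val A = c *: val B.
Proof.
rewrite /to_PGL; split=> [/eqmodP /proj_equivP // | eqAB].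
by apply/eqmodP/proj_equivP.
Qed.

Definition PGL_one : PGL := to_PGL 1%g.
Definition PGL_mul (x y : PGL) : PGL := to_PGL (generic_quotient.repr x * generic_quotient.repr y)%g.
Definition PGL_inv (x : PGL) : PGL := to_PGL (generic_quotient.repr x)^-1%g.

Fact to_PGL_repr (x : PGL) : to_PGL (generic_quotient.repr x) = x.
Proof. exact: reprK. Qed.

Fact PGL_mulE A B : PGL_mul (to_PGL A) (to_PGL B) = to_PGL (A * B)%g.
Proof.
have /to_PGL_eq[c nzc defA] := to_PGL_repr (to_PGL A).
have /to_PGL_eq[d nzd defB] := to_PGL_repr (to_PGL B).
apply/to_PGL_eq; exists (c * d); rewrite ?mulf_neq0 //.
by rewrite !val_GLM defA defB -scalemxAl -scalemxAr scalerA.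
Qed.

Fact PGL_invE A : PGL_inv (to_PGL A) = to_PGL A^-1%g.
Proof.
have /to_PGL_eq[c nzc defA] := to_PGL_repr (to_PGL A).
apply/to_PGL_eq; exists c^-1; rewrite ?invr_eq0 //.
rewrite !val_GLV defA invmxZ // -defA.
exact: valP (generic_quotient.repr (to_PGL A)).
Qed.

Fact PGL_mulA : associative PGL_mul.
Proof.
move=> x y z; rewrite -(to_PGL_repr x) -(to_PGL_repr y) -(to_PGL_repr z).
by rewrite !PGL_mulE mulgA.
Qed.
Fact PGL_mul1 : left_id PGL_one PGL_mul.
Proof. by move=> x; rewrite -(to_PGL_repr x) PGL_mulE mul1g. Qed.
Fact PGL_mulr1 : right_id PGL_one PGL_mul.
Proof. by move=> x; rewrite -(to_PGL_repr x) PGL_mulE mulg1. Qed.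
Fact PGL_mulV : left_inverse PGL_one PGL_inv PGL_mul.
Proof. by move=> x; rewrite -(to_PGL_repr x) PGL_invE PGL_mulE mulVg. Qed.
Fact PGL_mulrV : right_inverse PGL_one PGL_inv PGL_mul.
Proof. by move=> x; rewrite -(to_PGL_repr x) PGL_invE PGL_mulE mulgV. Qed.

HB.instance Definition _ :=
  isGroup.Build PGL PGL_mulA PGL_mul1 PGL_mulr1 PGL_mulV PGL_mulrV.

Lemma to_PGLM A B : to_PGL (A * B)%g = (to_PGL A * to_PGL B)%g.
Proof. exact/esym/PGL_mulE. Qed.

End GeneralLinear.

Arguments PGL : clear implicits.

(* The library's \isog compares subgroups of two finite group types; here the
   ambient group of the target may be infinite. *)
Definition isomorphic_to (aT : finGroupType) (A : {set aT})
    (hT : groupType) (B : {pred hT}) : Prop :=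
  exists f : aT -> hT,
    [/\ {in A &, {morph f : x y / (x * y)%g}},
        {in A &, injective f} &
        forall y, y \in B <-> exists2 x, x \in A & y = f x].

Section Projective.
Variables (F : fieldType) (gT : finGroupType) (G : {group gT}) (n : nat).
Variable rho : mx_representation F G n.

(* The default value 1 is only reached outside G; see val_repr_GL. *)
Definition repr_GL (g : gT) : GL F n := insubd (1%g : GL F n) (rho g).

Lemma val_repr_GL g : g \in G -> val (repr_GL g) = rho g.
Proof. by move=> Gg; rewrite val_insubd repr_mx_unit. Qed.

Definition proj_image : {pred PGL F n} :=
  [pred x | [exists g in G, x == to_PGL (repr_GL g)]].

End Projective.

(* Trace-zero 2 x 2 matrices, with coordinates in the basis
   H = E_00 - E_11, E_01, E_10. *)
Section Sl2.
Variable F : fieldType.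

Definition sl2_mx (v : 'cV[F]_3) : 'M[F]_2 :=
  v 0 0 *: (delta_mx 0 0 - delta_mx 1 1)
  + v 1 0 *: delta_mx 0 1 + v 2 0 *: delta_mx 1 0.

Definition sl2_coord (M : 'M[F]_2) : 'cV[F]_3 :=
  \col_i nth 0 [:: M 0 0; M 0 1; M 1 0] i.

Lemma sl2_mx_tr v : \tr (sl2_mx v) = 0.
Proof.
by rewrite /mxtrace !big_ord_recl big_ord0 !mxE /=; ring.
Qed.

Lemma sl2_mxK : cancel sl2_mx sl2_coord.
Proof.
move=> v; apply/colP=> i; rewrite !mxE /=.
case: i => [[|[|[|//]]] lti] /=; rewrite !(mulr0, mulr1, addr0, add0r, subr0, oppr0).
- by congr (v _ _); apply: val_inj.
- by congr (v _ _); apply: val_inj.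
- by congr (v _ _); apply: val_inj.
Qed.

Lemma sl2_coordK M : \tr M = 0 -> sl2_mx (sl2_coord M) = M.
Proof.
rewrite /mxtrace !big_ord_recl big_ord0 addr0 => trM.
have {trM} M11 : M 1 1 = - M 0 0.
  apply/eqP; rewrite -addr_eq0 addrC; apply/eqP; rewrite -[RHS]trM.
  by congr (_ + M _ _); apply: val_inj.
apply/matrixP=> i j; rewrite !mxE /=.
have o2 (k : 'I_2) : k = 0 \/ k = 1.
  by case: k => [[|[|//]] ltk]; [left | right]; apply: val_inj.
by case: (o2 i) => ->; case: (o2 j) => -> /=; rewrite ?M11; ring.
Qed.

Fact sl2_mx_is_linear : linear sl2_mx.
Proof. by move=> a u v; apply/matrixP=> i j; rewrite !mxE; ring. Qed.
HB.instance Definition _ :=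
  GRing.isLinear.Build F 'cV[F]_3 'M[F]_2 _ sl2_mx sl2_mx_is_linear.

Fact sl2_coord_is_linear : linear sl2_coord.
Proof.
move=> a M N; apply/colP=> i; rewrite !mxE.
by case: i => [[|[|[|//]]] lti] /=; rewrite ?mxE.
Qed.
HB.instance Definition _ :=
  GRing.isLinear.Build F 'M[F]_2 'cV[F]_3 _ sl2_coord sl2_coord_is_linear.

End Sl2.

Section Adjoint.
Variables (F : fieldType) (gT : finGroupType) (G : {group gT}).
Variable rho : mx_representation F G 2.

Definition Ad_act (g : gT) (M : 'M[F]_2) : 'M[F]_2 :=
  rho g *m M *m invmx (rho g).

(* Column j holds the coordinates of the image of the j-th basis vector. *)
Definition Ad_mx (g : gT) : 'M[F]_3 :=
  \matrix_(i, j) sl2_coord (Ad_act g (sl2_mx (delta_mx j 0))) i 0.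

Lemma Ad_act_tr g M : g \in G -> \tr (Ad_act g M) = \tr M.
Proof.
by move=> Gg; rewrite /Ad_act mxtrace_mulC mulmxA mulVmx ?mul1mx ?repr_mx_unit.
Qed.

Fact Ad_act_is_linear g : linear (Ad_act g).
Proof.
by move=> a M N; rewrite /Ad_act mulmxDr mulmxDl -scalemxAr -scalemxAl.
Qed.
HB.instance Definition _ g :=
  GRing.isLinear.Build F 'M[F]_2 'M[F]_2 _ (Ad_act g) (Ad_act_is_linear g).

Lemma Ad_mxE g v : g \in G -> sl2_mx (Ad_mx g *m v) = Ad_act g (sl2_mx v).
Proof.
move=> Gg; rewrite -[RHS]sl2_coordK ?Ad_act_tr ?sl2_mx_tr //; congr sl2_mx.
have {2}-> : v = \sum_j v j 0 *: delta_mx j 0.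
  by rewrite [LHS]matrix_sum_delta; apply: eq_bigr => j _; rewrite big_ord1.
rewrite !linear_sum; apply/colP=> i; rewrite mxE summxE; apply: eq_bigr => j _.
by rewrite !linearZ !mxE mulrC.
Qed.

Lemma Ad_mx_repr : mx_repr G Ad_mx.
Proof.
have ext (A B : 'M[F]_3) :
    (forall v : 'cV_3, sl2_mx (A *m v) = sl2_mx (B *m v)) -> A = B.
  move=> eqAB; apply/matrixP=> i j.
  have /(can_inj (@sl2_mxK F)) := eqAB (delta_mx j 0).
  by rewrite -!colE => /colP/(_ i); rewrite !mxE.
split=> [|g h Gg Gh]; apply: ext => v.
  by rewrite Ad_mxE // mul1mx /Ad_act repr_mx1 invmx1 mul1mx mulmx1.
rewrite -mulmxA !Ad_mxE ?groupM // /Ad_act -!repr_mxV ?groupM //.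
by rewrite invMg !repr_mxM ?groupV // !mulmxA.
Qed.

Canonical Ad_repr := MxRepresentation Ad_mx_repr.

Lemma sl2_coord_Ad g M : g \in G -> \tr M = 0 ->
  sl2_coord (Ad_act g M) = Ad_mx g *m sl2_coord M.
Proof.
move=> Gg trM; apply: (can_inj (@sl2_mxK F)).
by rewrite Ad_mxE // !sl2_coordK ?Ad_act_tr.
Qed.

(* mx_irreducible refers to stable spaces of row vectors, whereas Ad_mx g acts
   on coordinate columns; the two resulting notions agree. *)
Lemma Ad_irrP :
  mx_irreducible Ad_repr <->
  (forall W : {vspace 'M[F]_2},
     (forall M, M \in W -> \tr M = 0) ->
     (forall g M, g \in G -> M \in W -> Ad_act g M \in W) ->
     W = 0%VS \/ (forall M, \tr M = 0 -> M \in W)).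
Proof.
split=> [/mx_irrP[_ irr] W trW stW | irr].
  pose X := \matrix_(i < 3, j < \dim W) sl2_coord (vbasis W)`_j i 0.
  have kerX k (u : 'M_(k, 3)) : u *m X = 0 <->
      (forall M, M \in W -> u *m sl2_coord M = 0).
    have colX j : col j X = sl2_coord (vbasis W)`_j.
      by apply/colP=> i; rewrite !mxE.
    split=> [uX0 M WM | uW0].
      rewrite (coord_vbasis WM) linear_sum mulmx_sumr big1 // => j _.
      by rewrite linearZ -scalemxAr /= -colX colE mulmxA uX0 mul0mx scaler0.
    apply/matrixP=> i j; rewrite -[LHS]/((u *m X) i j).
    have := uW0 (vbasis W)`_j; rewrite vbasis_mem ?mem_nth ?size_tuple //.
    by move/(_ isT); rewrite -colX colE mulmxA -colE => /colP/(_ i); rewrite !mxE.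
  have modU : mxmodule Ad_repr (kermx X).
    apply/mxmoduleP=> g Gg; apply/sub_kermxP/kerX => M WM.
    rewrite -mulmxA -sl2_coord_Ad ?trW //.
    by move/kerX: (mulmx_ker X); apply; apply: stW.
  have [U0 | nzU] := eqVneq (kermx X) 0; [right=> M trM | left].
    have /row_freeP[Y XY1] : row_free X by rewrite -kermx_eq0 U0.
    pose N := \sum_j (Y *m sl2_coord M) j 0 *: (vbasis W)`_j.
    have WN : N \in W.
      by apply: memv_suml => j _; rewrite memvZ ?vbasis_mem ?mem_nth ?size_tuple.
    suff -> : M = N by [].
    rewrite -(sl2_coordK trM) -(sl2_coordK (trW _ WN)); congr sl2_mx.
    rewrite -[LHS]mul1mx -XY1 -mulmxA linear_sum /=.
    apply/colP=> i; rewrite mxE summxE; apply: eq_bigr => j _.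
    by rewrite linearZ !mxE mulrC.
  have X0 : X = 0.
    have := irr _ modU nzU; rewrite -sub1mx => /sub_kermxP.
    by rewrite mul1mx.
  apply/eqP; rewrite -subv0; apply/subvP=> M WM; rewrite memv0 -(sl2_coordK (trW _ WM)).
  have /kerX/(_ M WM) : (1%:M : 'M_3) *m X = 0 by rewrite mul1mx.
  by rewrite mul1mx => ->; rewrite linear0.
apply/mx_irrP; split=> // U modU nzU.
have lint : linear (fun M : 'M[F]_2 => (\tr M)%:M : 'M_1).
  by move=> a A B; rewrite linearP /= rmorphD /= -scale_scalar_mx.
have linU : linear (fun M : 'M[F]_2 => U *m sl2_coord M).
  by move=> a A B; rewrite linearP /= mulmxDr scalemxAr.
pose t : {linear 'M[F]_2 -> 'M[F]_1} := HB.pack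
  (fun M : 'M[F]_2 => (\tr M)%:M : 'M_1) (GRing.isLinear.Build _ _ _ _ _ lint).
pose f : {linear 'M[F]_2 -> 'cV[F]_3} := HB.pack
  (fun M : 'M[F]_2 => U *m sl2_coord M) (GRing.isLinear.Build _ _ _ _ _ linU).
pose W := (lker (linfun t) :&: lker (linfun f))%VS.
have memW M : (M \in W) = (\tr M == 0) && (U *m sl2_coord M == 0).
  rewrite memv_cap !memv_ker (lfunE t) (lfunE f) /=; congr (_ && _).
  apply/eqP/eqP => [/matrixP/(_ 0 0) | ->]; last by rewrite raddf0.
  by rewrite !mxE.
case: (irr W) => [M | g M Gg | W0 | Wall].
- by rewrite memW => /andP[/eqP].
- rewrite !memW => /andP[/eqP trM /eqP UM]; rewrite Ad_act_tr // trM eqxx /=.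
  rewrite sl2_coord_Ad // mulmxA.
  have /submxP[D ->] := mxmoduleP modU g Gg.
  by rewrite -mulmxA UM mulmx0.
- rewrite /row_full -mxrank_tr -[_ == _]/(row_free U^T) -kermx_eq0.
  apply/eqP/row_matrixP=> i; rewrite row0.
  have := mulmx_ker U^T; move/(congr1 (row i)); rewrite row_mul row0.
  set u := row i _ => uU0.
  have : sl2_mx u^T \in W.
    by rewrite memW sl2_mx_tr eqxx sl2_mxK -[U]trmxK -trmx_mul uU0 trmx0 eqxx.
  rewrite W0 memv0 => /eqP/(congr1 (@sl2_coord F)); rewrite sl2_mxK linear0.
  by move/(congr1 trmx); rewrite trmxK trmx0.
- case/eqP: nzU; apply/matrixP=> i j.
  have := Wall _ (sl2_mx_tr (delta_mx j 0)).
  rewrite memW sl2_mxK -colE => /andP[_ /eqP/colP/(_ i)].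
  by rewrite !mxE.
Qed.

End Adjoint.

(* Main.v *)
Require Import Defs.
From mathcomp Require Import all_boot all_order all_algebra all_fingroup.
From mathcomp Require Import all_solvable all_character.
From mathcomp Require Import zify ring.

(* Let Z be the subgroup of G acting by scalars, so that H = G / Z is the
   projective image.  For g outside Z, the elements of G commuting with g form,
   modulo Z, a "torus" of H.  Commutation is transitive among nonscalar 2 x 2
   matrices, so the tori partition H minus 1.  If h normalises the torus of g,
   then conjugation by h multiplies the traceless part M of rho(g) by a scalar,
   equal to 1 or -1 since det M <> 0 (rho(g) has finite order); hence a torus has
   index at most 2 in its normaliser.  Irreducibility of Ad(rho) says that no
   line of traceless matrices is stable, so no torus is normal.  The class
   equation then becomes a sum of unit fractions that leaves |H| = 12, 24 or 60,
   and H acts faithfully on the cosets of a subgroup of index 4, 4 or 5.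

   Conversely, if Ad(rho) is reducible, it stabilises a line spanned by some M
   (if A, B span a stable plane, take M = AB - BA).  Irreducibility of rho gives
   det M <> 0, so each rho(g) commutes or anticommutes with M, each rho(g)^2
   commutes with M, and squares commute in the projective image.  The squares of
   two 3-cycles sharing two points do not commute. *)

Set Implicit Arguments.
Unset Strict Implicit.
Unset Printing Implicit Defensive.

(** * Subgroups of symmetric groups *)

Import GroupScope.

Lemma acts_faithful_isog (aT : finGroupType) (rT : finType)
    (to : {action aT &-> rT}) (H : {group aT}) (S : {set rT}) x0 :
    x0 \in S -> [acts H, on S | to] -> [faithful H, on S | to] ->
  exists K : {group {perm 'I_#|S|}}, H \isog K.
Proof.
move=> Sx0 aH fH.
(* [<[aH]>] fixes everything when [a] lies outside [H], so [act a] is a permutation for every [a],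
   not only for those in [H]. *)
pose act a (i : 'I_#|S|) : 'I_#|S| := enum_rank_in Sx0 (<[aH]>%act (enum_val i) a).
have actE a i : enum_val (act a i) = <[aH]>%act (enum_val i) a.
  rewrite enum_rankK_in //= /actby enum_valP /=.
  by case: ifP => [Ha|_]; rewrite ?enum_valP // (acts_act aH) ?enum_valP.
have act_inj a : injective (act a).
  by move=> i j /(congr1 enum_val); rewrite !actE => /act_inj/enum_val_inj.
have actV a i : a \in H -> enum_val (perm (act_inj a) i) = to (enum_val i) a.
  by move=> Ha; rewrite permE actE /= /actby enum_valP Ha.
have fM : {in H &, {morph (fun a => perm (act_inj a)) : a b / a * b}}.
  move=> a b Ha Hb; apply/permP=> i; apply: enum_val_inj.
  by rewrite permM !actV ?groupM // actM.
exists (Morphism fM @* H)%G; apply: sub_isog => //.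
apply/injmP=> a b Ha Hb /= eqab; apply/eqP; rewrite eq_mulgV1.
have := subsetP fH (a * b^-1); rewrite !inE; apply; rewrite groupM ?groupV //=.
apply/subsetP=> x Sx; rewrite inE actM /=.
have /(congr1 enum_val) := congr1 (fun p : {perm _} => p (enum_rank_in Sx0 x)) eqab.
by rewrite !actV // enum_rankK_in // => ->; rewrite actK.
Qed.

(* The two cosets give a morphism to Z/2; it takes the same value on all
   transpositions, as these are conjugate. *)
Lemma index2_Sym_Alt (T : finType) (K : {group {perm T}}) :
  #|'Sym_T : K| = 2 -> K :=: 'Alt_T.
Proof.
move=> iK.
have nK : K <| 'Sym_T by apply: index2_normal; rewrite ?subsetT.
have NK p : p \in 'N(K) by rewrite (subsetP (normal_norm nK)) ?inE.
have [t nKt] : exists t, t \notin K.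
  apply/existsP; rewrite -negb_forall; apply/negP=> /forallP allK.
  suff: 'Sym_T \subset K by move/(fun s => etrans (esym iK) (eqP (etrans (indexg_eq1 _ _) s))).
  by apply/subsetP=> p _.
have KM p q : (p * q \in K) = ((p \in K) == (q \in K)).
  have [Kp|nKp] := boolP (p \in K); first by rewrite groupMl.
  have [Kq|nKq] := boolP (q \in K); first by rewrite groupMr // (negPf nKp).
  have: #|'Sym_T / K| = 2 by rewrite card_quotient ?normal_norm.
  move=> c2; have [x def1] : exists x, 'Sym_T / K = <[x]>.
    by apply/cyclicP; apply: prime_cyclic; rewrite c2.
  have coK u : (coset K u == 1) = (u \in K).
    by apply: (sameP eqP); apply: (iffP idP) => [/coset_id|/coset_idr->].
  have ox : #[x] = 2 by rewrite -c2 def1.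
  have cox u : u \notin K -> coset K u = x.
    rewrite -coK; have: coset K u \in <[x]> by rewrite -def1 mem_quotient ?inE.
    by case/cycleP=> k ->; rewrite -(expg_mod_order x) ox modn2; case: (odd k); rewrite ?eqxx.
  by rewrite -coK morphM //= !cox // -[x * x]/(x ^+ 2) -{1}ox expg_order !eqxx.
have KJ p q : (p ^ q \in K) = (p \in K) by rewrite memJ_norm.
(* Two conjugations carry one transposition to the other: [s1] moves [x1] to [x2], then a
   transposition fixing [x2] moves [s1 y1] to [y2]. *)
have KT x1 y1 x2 y2 : x1 != y1 -> x2 != y2 -> (tperm x1 y1 \in K) = (tperm x2 y2 \in K).
  move=> n1 n2; set s1 := tperm x1 x2.
  have n3 : s1 y1 != x2 by rewrite -(tpermL x1 x2) (inj_eq perm_inj) eq_sym.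
  rewrite -(KJ _ s1) tpermJ tpermL -/s1 -(KJ _ (tperm (s1 y1) y2)) tpermJ tpermL.
  by rewrite tpermD // eq_sym.
have Kodd p : (tperm p.1 p.2 \in K) -> p.1 != p.2 -> forall q : {perm T}, q \in K.
  move=> Kp np q; have [ts -> /allP dts] := prod_tpermP q.
  elim: ts dts => [|r ts IH] dts; first by rewrite big_nil group1.
  rewrite big_cons groupM ?IH // => [|u uts]; last by apply: dts; rewrite inE uts orbT.
  by rewrite (KT _ _ p.1 p.2) //; apply: dts; rewrite mem_head.
have nKtp x y : x != y -> tperm x y \notin K.
  by move=> nxy; apply/negP=> Kxy; rewrite (Kodd (x, y)) in nKt.
apply/setP=> q; rewrite Alt_even; have [ts -> /allP dts] := prod_tpermP q.
elim: ts dts => [|p ts IH] dts; first by rewrite big_nil group1 odd_perm1.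
rewrite big_cons KM odd_permM IH; last by move=> r rts; apply: dts; rewrite inE rts orbT.
have np : p.1 != p.2 by apply: dts; rewrite mem_head.
by rewrite (negPf (nKtp _ _ np)) odd_tperm np; case: odd_perm.
Qed.

(** The action on the right cosets of [M] has the core of [M] as its kernel. *)
Lemma isog_subgroup_Sym (hT : finGroupType) (H M : {group hT}) n :
  M \subset H -> gcore M H = 1 -> #|H : M| = n ->
  exists K : {group {perm 'I_n}}, H \isog K.
Proof.
move=> sMH coreM <-.
apply: (@acts_faithful_isog _ _ 'Rs _ (rcosets M H) M).
- by apply/rcosetsP; exists 1; rewrite ?group1 // rcoset1.
- exact: actsRs_rcosets.
by rewrite /faithful astabRs_rcosets coreM subsetIr.
Qed.

Lemma noncommuting_squares (T : finType) (x y z t : T) :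
  uniq [:: x; y; z; t] ->
  let a := (tperm x y * tperm x z) in let b := (tperm x y * tperm x t) in
  [/\ a \in 'Alt_T, b \in 'Alt_T & a ^+ 2 * b ^+ 2 != b ^+ 2 * a ^+ 2].
Proof.
move=> u a b.
have /and4P[/and3P[xy xz xt] /andP[yz yt] zt _] :
    [&& [&& x != y, x != z & x != t], (y != z) && (y != t), z != t & true].
  by move: u; rewrite /= !inE !negb_or.
rewrite {}/a {}/b; split; rewrite ?Alt_even ?odd_permM ?odd_tperm ?xy ?xz ?xt //.
(* Evaluate at [x]: [a ^+ 2] sends it to [z], which [b] fixes, whereas [b ^+ 2] sends it to [t],
   which [a] fixes. *)
apply/negP=> /eqP E; have := congr1 (fun p : {perm T} => p x) E.
rewrite !expgS !expg0 !mulg1 !permM.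
have [zy ty tz] : [/\ z != y, t != y & t != z] by split; rewrite eq_sym.
rewrite !(tpermL, tpermR, tpermD xy zy, tpermD xy ty, tpermD xz yz, tpermD xz tz,
  tpermD xt yt, tpermD xt zt).
exact/eqP.
Qed.

(** All elements outside [K] share one right coset: apply the hypothesis to [b] and [a^-1]. *)
Lemma index_le2 (gT : finGroupType) (K N : {group gT}) : K \subset N ->
  {in N &, forall a b, a \notin K -> b \notin K -> a * b \in K} ->
  (#|N : K| <= 2)%N.
Proof.
move=> sKN KM; have [sNK|/subsetPn[a Na nKa]] := boolP (N \subset K).
  by have /eqP-> : #|N : K| == 1%N by rewrite indexg_eq1.
apply: leq_trans (_ : #|[set (K : {set gT}); K :* a]| <= 2)%N; last first.
  by rewrite cards2; case: (_ != _).
apply/subset_leq_card/subsetP=> _ /rcosetsP[b Nb ->]; rewrite !inE.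
have [Kb|nKb] := boolP (b \in K); first by rewrite rcoset_id ?eqxx.
apply/orP; right; apply/eqP/rcoset_eqP; rewrite mem_rcoset.
by apply: KM; rewrite ?groupV.
Qed.

(** * Class equation of a torus partition *)

Local Open Scope nat_scope.

(** Linearises the products [n * e] for [lia]. The cut-off 6 suffices because the torus orders that
    survive the class equation are at most 5. *)
Lemma mul_cases n e : 2 <= e ->
  e = 2 /\ n * e = 2 * n \/ e = 3 /\ n * e = 3 * n \/ e = 4 /\ n * e = 4 * n \/
  e = 5 /\ n * e = 5 * n \/ 6 <= e /\ 6 * n <= n * e.
Proof.
case: e => [|[|[|[|[|[|e]]]]]] //= _; [by left; lia| by right; left; lia| by do 2!right; left; lia|
 by do 3!right; left; lia|].
by do 4!right; split=> //; rewrite mulnC leq_mul2l orbT.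
Qed.

(** Here and below [N] is the group order. A class of tori has [a] members (at least 2, as no torus
    is normal), of order [e1] and of index [f1] in their normalisers, hence [a * e1.-1] nontrivial
    elements. *)
Lemma two_class_orders N a b e1 e2 f1 f2 :
    2 <= a -> 2 <= b -> 2 <= e1 -> 2 <= e2 -> f1 = 1 \/ f1 = 2 -> f2 = 1 \/ f2 = 2 ->
    N = a * e1 * f1 -> N = b * e2 * f2 -> N = 1 + (a * e1.-1 + b * e2.-1) ->
  N = 12 /\ (e1 = 3 /\ f1 = 1 \/ e2 = 3 /\ f2 = 1).
Proof.
move=> a2 b2 /(mul_cases a) E1 /(mul_cases b) E2 F1 F2 D1 D2.
rewrite -!subn1 !mulnBr !muln1 => eqN.
have {D1}D1 : N = a * e1 /\ f1 = 1 \/ N = 2 * (a * e1) /\ f1 = 2.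
  by case: F1 => F1; rewrite F1 in D1; lia.
have {D2}D2 : N = b * e2 /\ f2 = 1 \/ N = 2 * (b * e2) /\ f2 = 2.
  by case: F2 => F2; rewrite F2 in D2; lia.
clear F1 F2; move: (a * e1) (b * e2) E1 E2 eqN D1 D2 => m1 m2 E1 E2 eqN.
by case=> -[? ?]; case=> -[? ?]; subst f1 f2; lia.
Qed.

(* With m = N / 2 this is 1/e1 + 1/e2 + 1/e3 = 1 + 1/m, since a = m/e1, etc. *)
Lemma three_class_sum m a b c e1 e2 e3 :
    2 <= a -> 2 <= b -> 2 <= c -> 2 <= e1 -> 2 <= e2 -> 2 <= e3 ->
    m = a * e1 -> m = b * e2 -> m = c * e3 -> m + 1 = a + b + c -> e1 <= e2 <= e3 ->
  e1 = 2 /\ e2 = 3 /\ (e3 = 3 /\ m = 6 \/ e3 = 4 /\ m = 12 \/ e3 = 5 /\ m = 30).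
Proof.
move=> a2 b2 c2 /(mul_cases a) E1 /(mul_cases b) E2 /(mul_cases c) E3.
move=> D1; rewrite -{}D1 in E1 => D2; rewrite -{}D2 in E2 => D3; rewrite -{}D3 in E3.
move=> eqN /andP[le12 le23].
(* Both [e1 >= 3] and [e2 >= 4] would give a + b + c <= m. The dihedral case [e2 = 2] would give c =
   1, a normal torus. *)
have e12 : e1 = 2 /\ m = 2 * a by lia.
have e23 : e2 = 3 /\ m = 3 * b by clear E1; lia.
clear E1 E2; lia.
Qed.

(** Divided by [N], a class contributes (1 - 1/e)/f: at least 1/2 if [f] is 1, at least 1/4 if [f]
    is 2. A single [f] equal to 1 brings the three classes to at least 1, but their total is 1 -
    1/N. *)
Lemma three_class_normalizers N a b c e1 e2 e3 f1 f2 f3 :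
    2 <= e1 -> 2 <= e2 -> 2 <= e3 ->
    f1 = 1 \/ f1 = 2 -> f2 = 1 \/ f2 = 2 -> f3 = 1 \/ f3 = 2 ->
    N = a * e1 * f1 -> N = b * e2 * f2 -> N = c * e3 * f3 ->
    N = 1 + (a * e1.-1 + (b * e2.-1 + c * e3.-1)) ->
  [/\ f1 = 2, f2 = 2 & f3 = 2].
Proof.
move=> /(leq_mul (leqnn a)) E1 /(leq_mul (leqnn b)) E2 /(leq_mul (leqnn c)) E3.
rewrite -!subn1 !mulnBr !muln1 => F1 F2 F3 D1 D2 D3.
move: (a * e1) (b * e2) (c * e3) E1 E2 E3 D1 D2 D3 => m1 m2 m3 *.
by case: F1 F2 F3 => F1 [] F2 [] F3; subst f1 f2 f3; split=> //; exfalso; lia.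
Qed.

Lemma three_class_orders N a b c e1 e2 e3 f1 f2 f3 :
    2 <= a -> 2 <= b -> 2 <= c -> 2 <= e1 -> 2 <= e2 -> 2 <= e3 ->
    f1 = 1 \/ f1 = 2 -> f2 = 1 \/ f2 = 2 -> f3 = 1 \/ f3 = 2 ->
    N = a * e1 * f1 -> N = b * e2 * f2 -> N = c * e3 * f3 ->
    N = 1 + (a * e1.-1 + (b * e2.-1 + c * e3.-1)) -> e1 <= e2 <= e3 ->
  [/\ f1 = 2, f2 = 2, e1 = 2, e2 = 3 &
     e3 = 3 /\ N = 12 \/ e3 = 4 /\ N = 24 \/ e3 = 5 /\ N = 60].
Proof.
move=> a2 b2 c2 e1_2 e2_2 e3_2 F1 F2 F3 D1 D2 D3 eqN le123.
have [F1' F2' F3'] := three_class_normalizers e1_2 e2_2 e3_2 F1 F2 F3 D1 D2 D3 eqN.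
subst f1 f2 f3; rewrite -!subn1 !mulnBr !muln1 in eqN.
move: (leq_mul (leqnn a) e1_2) (leq_mul (leqnn b) e2_2) (leq_mul (leqnn c) e3_2) => *.
(* With every [f] equal to 2, the class equation becomes m + 1 = a + b + c for m = N / 2. *)
have [||||E1 [E2 E]] :=
  @three_class_sum (a * e1) _ _ _ _ _ _ a2 b2 c2 e1_2 e2_2 e3_2 _ _ _ _ le123.
- by [].
- by lia.
- by lia.
- by lia.
by split=> //; lia.
Qed.

(** Each class has at least N/4 nontrivial elements, so four classes exceed the N - 1 available; [s]
    stands for the remaining classes. *)
Lemma four_class_bound N a b c d e1 e2 e3 e4 f1 f2 f3 f4 s :
    2 <= e1 -> 2 <= e2 -> 2 <= e3 -> 2 <= e4 ->
    f1 = 1 \/ f1 = 2 -> f2 = 1 \/ f2 = 2 -> f3 = 1 \/ f3 = 2 -> f4 = 1 \/ f4 = 2 ->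
    N = a * e1 * f1 -> N = b * e2 * f2 -> N = c * e3 * f3 -> N = d * e4 * f4 ->
  N <= a * e1.-1 + (b * e2.-1 + (c * e3.-1 + (d * e4.-1 + s))).
Proof.
have quarter n e f : 2 <= e -> f = 1 \/ f = 2 -> N = n * e * f -> N <= 4 * (n * e.-1).
  move=> /(leq_mul (leqnn n)); rewrite -subn1 mulnBr muln1.
  by move: (n * e) => m ? [] ->; lia.
move=> e1_2 e2_2 e3_2 e4_2 F1 F2 F3 F4.
move=> /(quarter _ _ _ e1_2 F1) ? /(quarter _ _ _ e2_2 F2) ?.
by move=> /(quarter _ _ _ e3_2 F3) ? /(quarter _ _ _ e4_2 F4) ?; lia.
Qed.

(** * Counting in a group partitioned by tori *)

Section TorusPartition.
(* [T x] is the block of [x <> 1] in a partition of [H] minus 1; the value [T 1]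
   plays no role (it is [H] itself in the application). *)
Variables (hT : finGroupType) (H : {group hT}) (T : hT -> {group hT}).
Hypothesis T_sub : {in H, forall x, T x \subset H}.
Hypothesis T_id : {in H, forall x, x \in T x}.
Hypothesis T_eq : {in H^#, forall x y, y \in T x -> y != 1%g -> T y = T x}.
Hypothesis T_conj : {in H &, forall x g, T (x ^ g)%g = (T x :^ g)%G}.
Hypothesis T_index : {in H^#, forall x, #|'N_H(T x) : T x| <= 2}.
Hypothesis T_nonnormal : {in H^#, forall x, ~~ (H \subset 'N(T x))}.

Let n x := #|T x :^: H|.
Let e x := #|T x|.
Let f x := #|'N_H(T x) : T x|.

Lemma torus_mem_eq x y : x \in H^# -> (y \in (T x)^#) = (y \in H^#) && (T y == T x).
Proof.
move=> Hx; rewrite !inE; have /setD1P[_ Hx'] := Hx.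
case: eqVneq => //= ny; apply/idP/andP=> [Txy | [Hy /eqP <-]]; last exact: T_id.
by rewrite (T_eq Hx Txy ny) (subsetP (T_sub Hx')).
Qed.

Lemma torus_conj_mem x y : x \in H^# -> y \in H^# ->
  (T y :^: H == T x :^: H) = (gval (T y) \in T x :^: H).
Proof.
move=> Hx Hy; apply/eqP/idP=> [<- | /imsetP[g Hg ->]].
  by apply/imsetP; exists 1%g; rewrite ?group1 ?conjsg1.
apply/setP=> B; apply/imsetP/imsetP=> -[h Hh ->].
  by exists (g * h)%g; rewrite ?groupM // conjsgM.
by exists (g^-1 * h)%g; rewrite ?groupM ?groupV // conjsgM conjsgK.
Qed.

(** Each conjugate of [T x] is itself a block of the partition, so conjugates meet only in 1. *)
Lemma torus_class_card x : x \in H^# ->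
  #|[set y in H^# | T y :^: H == T x :^: H]| = n x * (e x).-1.
Proof.
move=> Hx; have /setD1P[nx Hx'] := Hx.
rewrite -sum1_card (partition_big (fun y => gval (T y)) (mem (T x :^: H))) /=; last first.
  by move=> y; rewrite inE => /andP[Hy]; rewrite torus_conj_mem.
rewrite -sum_nat_const; apply: eq_bigr => _ /imsetP[g Hg ->].
have -> : (e x).-1 = #|(T x :^ g)^#|.
  by rewrite /e -(cardJg (T x) g) (cardsD1 1%g (T x :^ g)) group1.
have Hxg : (x ^ g)%g \in H^# by rewrite !inE conjg_eq1 nx groupJ.
have TgE : T (x ^ g)%g = (T x :^ g)%G by apply: T_conj.
rewrite -sum1_card; apply: eq_bigl => y; have := torus_mem_eq y Hxg; rewrite TgE /= => ->.
rewrite inE -andbA; case Hy: (y \in H^#) => //=.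
rewrite torus_conj_mem // -val_eqE /=; apply/andP/idP=> [[] // | /eqP->]; split=> //.
by apply/imsetP; exists g.
Qed.

Lemma torus_card x : x \in H^# -> #|H| = n x * e x * f x.
Proof.
move=> /setD1P[nx Hx]; rewrite /n card_conjugates -mulnA Lagrange.
  by rewrite mulnC Lagrange ?subsetIl.
by rewrite subsetI T_sub ?normG.
Qed.

Lemma torus_bounds x : x \in H^# -> [/\ 2 <= n x, 2 <= e x & f x = 1 \/ f x = 2].
Proof.
move=> Hx; have /setD1P[nx Hx'] := Hx; split.
- rewrite ltnNge; apply: contra (T_nonnormal Hx) => n1.
  rewrite /n card_conjugates in n1.
  have: #|H : 'N_H(T x)| == 1 by rewrite eqn_leq n1 indexg_gt0.
  by rewrite indexg_eq1 subsetI subxx.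
- by rewrite cardG_gt1; apply: contraNneq nx => T1; have := T_id Hx'; rewrite T1 => /set1P->.
have := T_index Hx; have := indexg_gt0 'N_H(T x) (T x).
by rewrite /f; case: #|_ : _| => [|[|[|]]]; auto.
Qed.

(** One representative is chosen per conjugacy class of tori. Sorting by torus order provides the
    hypothesis [e1 <= e2 <= e3] of [three_class_orders]. *)
Lemma torus_reps : exists xs : seq hT,
  [/\ {subset xs <= H^#}, sorted (relpre e leq) xs, #|H| = 1 + \sum_(x <- xs) n x * (e x).-1 &
      {in H^#, forall y, exists2 x, x \in xs & gval (T y) \in T x :^: H}].
Proof.
pose P := [set T x :^: H | x in H^#].
(* The default [1] is reached only for [O] outside [P]. *)
pose rep (O : {set {set hT}}) := odflt 1%g [pick x in H^# | O == T x :^: H].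
have repP O : O \in P -> rep O \in H^# /\ O = T (rep O) :^: H.
  case/imsetP=> x Hx ->; rewrite /rep; case: pickP => [y /andP[Hy /eqP] //|].
  by move/(_ x); rewrite Hx eqxx.
pose xs := sort (relpre e leq) (map rep (enum P)).
have xsE : xs =i map rep (enum P) by apply/perm_mem/permEl/perm_sort.
exists xs; split.
- by move=> x; rewrite xsE => /mapP[O + ->]; rewrite mem_enum => /repP[].
- by apply: sort_sorted => x y; apply: leq_total.
- rewrite (perm_big _ (permEl (perm_sort _ _))) big_map big_enum /= (cardsD1 1%g H) group1.
  congr addn; rewrite -sum1_card (partition_big_imset (fun x => T x :^: H)) /=.
  apply: eq_bigr => O PO; have [Hr defO] := repP O PO.
  rewrite -torus_class_card // -defO -sum1_card.
  by apply: eq_bigl => y; rewrite inE.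
move=> y Hy; have PO : T y :^: H \in P by apply: imset_f.
have [Hr defO] := repP _ PO.
exists (rep (T y :^: H)); first by rewrite xsE map_f ?mem_enum.
by rewrite -torus_conj_mem // -defO.
Qed.

Lemma torus_types : H :!=: 1%g ->
  [\/ #|H| = 12 /\ exists x, [/\ x \in H^#, e x = 3 & f x = 1],
      #|H| = 24 /\ exists x, [/\ x \in H^#, e x = 3 & f x = 2] |
      #|H| = 60 /\ exists x, [/\ x \in H^#, e x = 2, f x = 2 &
         {in H^#, forall y, ~~ odd (e y) -> gval (T y) \in T x :^: H}]].
Proof.
move=> nt1; have [xs [Hxs sxs cardH coverH]] := torus_reps.
have {Hxs} xsP x : x \in xs -> x \in H^# /\ #|H| = n x * e x * f x /\
    2 <= n x /\ 2 <= e x /\ (f x = 1 \/ f x = 2).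
  by move=> /Hxs Hx; have [? ? ?] := torus_bounds Hx; do !split=> //; apply: torus_card.
have N2 : 2 <= #|H| by rewrite cardG_gt1.
case: xs => [|a [|b [|c [|d xs]]]] in cardH xsP sxs coverH *.
- by rewrite big_nil in cardH; lia.
(* A single class is impossible: [n a * e a] exceeds [1 + n a * (e a).-1] as soon as [n a >= 2]. *)
- rewrite big_seq1 in cardH; have [_ [? [? [? ?]]]] := xsP a (mem_head _ _).
  by exfalso; nia.
- rewrite !big_cons big_nil addn0 in cardH.
  have [Ha [Na [na [ea fa]]]] := xsP a ltac:(by rewrite !inE eqxx).
  have [Hb [Nb [nb [eb fb]]]] := xsP b ltac:(by rewrite !inE eqxx orbT).
  have [H12 E] := two_class_orders na nb ea eb fa fb Na Nb cardH.
  by constructor 1; split=> //; case: E => -[e3 f1]; [exists a | exists b].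
- rewrite !big_cons big_nil addn0 in cardH.
  have [Ha [Na [na [ea fa]]]] := xsP a ltac:(by rewrite !inE eqxx).
  have [Hb [Nb [nb [eb fb]]]] := xsP b ltac:(by rewrite !inE eqxx orbT).
  have [Hc [Nc [nc [ec fc]]]] := xsP c ltac:(by rewrite !inE eqxx !orbT).
  rewrite /= andbT in sxs.
  have [fa2 fb2 ea2 eb3 E] := three_class_orders na nb nc ea eb ec fa fb fc Na Nb Nc cardH sxs.
  case: E => [[ec3 H12]|[[_ H24]|[ec5 H60]]].
  (* The solution (2, 3, 3) would give two Sylow 3-subgroups, but their number is 1 modulo 3. *)
  + have sylT : 3.-Sylow(H) (T b).
      by rewrite pHallE T_sub ?(setD1P Hb).2 //= -/(e b) eb3 H12 p_part.
    have := card_Syl_mod H (isT : prime 3).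
    rewrite (card_Syl sylT) -card_conjugates -/(n b).
    by have -> : n b = 2 by rewrite H12 eb3 fb2 in Nb; lia.
  + by constructor 2; split=> //; exists b.
  (* The other two classes have the odd torus orders 3 and 5, so every torus of even order is
     conjugate to [T a]. *)
  constructor 3; split=> //; exists a; split=> // y Hy ey.
  have [x xx Tyx] := coverH y Hy.
  have ex : e x = e y by case/imsetP: Tyx => g _ /= Tg; rewrite /e Tg cardJg.
  by move: xx; rewrite !inE => /or3P[] /eqP xE; subst x; rewrite // -ex ?eb3 ?ec5 in ey.
rewrite !big_cons in cardH.
have [_ [Na [_ [ea fa]]]] := xsP a ltac:(by rewrite !inE eqxx).
have [_ [Nb [_ [eb fb]]]] := xsP b ltac:(by rewrite !inE eqxx orbT).
have [_ [Nc [_ [ec fc]]]] := xsP c ltac:(by rewrite !inE eqxx !orbT).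
have [_ [Nd [_ [ed fd]]]] := xsP d ltac:(by rewrite !inE eqxx !orbT).
have := four_class_bound (\sum_(x <- xs) n x * (e x).-1) ea eb ec ed fa fb fc fd Na Nb Nc Nd.
by rewrite [X in X <= _]cardH ltnn.
Qed.

(** A nontrivial [y] in [K] has all its conjugates in [T x], so every conjugate of this torus
    coincides with it. *)
Lemma normal_sub_torus (K : {group hT}) x : K <| H -> x \in H^# -> K \subset T x -> K :=: 1%g.
Proof.
move=> nKH Hx sKT; apply/eqP; apply: contraT => /trivgPn[y Ky ny].
have Hy : y \in H^# by rewrite !inE ny (subsetP (normal_sub nKH)).
case/negP: (T_nonnormal Hy); apply/subsetP=> g Hg.
have Kyg : (y ^ g)%g \in K by rewrite memJ_norm // (subsetP (normal_norm nKH)).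
have /setD1P[_ Hy'] := Hy.
have eqT : T y = T x by apply: T_eq => //; apply: (subsetP sKT).
have : T (y ^ g)%g = T x by apply: T_eq; rewrite ?conjg_eq1 // (subsetP sKT).
by rewrite T_conj // -eqT => eqTg; apply/normP; apply: congr1 eqTg.
Qed.

(** A group of prime order is generated by any nontrivial [y] in it, hence lies in [T y]. *)
Lemma normal_prime_torus (K : {group hT}) : K <| H -> ~~ prime #|K|.
Proof.
move=> nKH; apply/negP=> prK.
have nt1 : K :!=: 1%g by rewrite -cardG_gt1 prime_gt1.
have [y Ky ny] := trivgPn _ nt1.
have Hy : y \in H^# by rewrite !inE ny (subsetP (normal_sub nKH)).
case/eqP: nt1; apply: (normal_sub_torus nKH Hy).
have -> : K :=: <[y]>%g.
  have /primeP[_ /(_ _ (order_dvdG Ky))] := prK; rewrite order_eq1 (negPf ny) => /eqP oy.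
  by apply/esym/eqP; rewrite eqEcard cycle_subG Ky -[#|<[y]>%g|]/#[y]%g oy leqnn.
by rewrite cycle_subG T_id ?(setD1P Hy).2.
Qed.

(** * Recognition of the three groups by coset actions *)

Lemma isog_Alt m (M : {group hT}) : M \subset H -> gcore M H = 1%g ->
  #|H : M| = m -> 2 * #|H| = m`! -> H \isog 'Alt_('I_m).
Proof.
move=> sMH coreM iM oH; have [K isoK] := isog_subgroup_Sym sMH coreM iM.
rewrite -(@index2_Sym_Alt _ K) // -divgS ?subsetT //.
by rewrite card_Sym card_ord -(card_isog isoK) -oH mulnK ?cardG_gt0.
Qed.

Lemma torus_isog12 x : #|H| = 12 -> x \in H^# -> e x = 3 -> H \isog 'Alt_('I_4).
Proof.
move=> H12 Hx e3; have /setD1P[_ Hx'] := Hx.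
have sTH := T_sub Hx'.
apply: (isog_Alt sTH); rewrite ?H12 //.
  apply: (@normal_sub_torus (gcore_group (T x) H) x) => //; first exact: gcore_normal.
  exact: gcore_sub.
by rewrite -divgS // H12 -/(e x) e3.
Qed.

Lemma torus_isog24 x : #|H| = 24 -> x \in H^# -> e x = 3 -> f x = 2 ->
  H \isog 'Sym_('I_4).
Proof.
move=> H24 Hx e3 f2; have /setD1P[nx Hx'] := Hx; have sTH := T_sub Hx'.
pose M := ('N_H(T x))%G.
have sTM : T x \subset M by rewrite subsetI sTH normG.
have oM : #|M| = 6 by rewrite -(Lagrange sTM) -/(e x) -/(f x) e3 f2.
have sMH : M \subset H by apply: subsetIl.
pose C := gcore_group M H; have nC : C <| H by apply: gcore_normal.
have sCM : C \subset M by apply: gcore_sub.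
have C1 : C :=: 1%g.
  have := cardSg sCM; rewrite oM dvdn_divisors // !inE => /or4P[] /eqP oC.
  - exact: card1_trivg.
  - by have := normal_prime_torus nC; rewrite oC.
  - by have := normal_prime_torus nC; rewrite oC.
  (* If [M] were normal in [H], so would be [T x], which is characteristic in [M] as its normal
     Sylow 3-subgroup. *)
  have eqCM : C :=: M by apply/eqP; rewrite eqEcard sCM oM oC.
  have OT : 'O_3(M) = T x.
    apply: normal_Hall_pcore; last by rewrite /normal sTM subsetIr.
    by rewrite pHallE sTM -/(e x) e3 oM p_part.
  case/negP: (T_nonnormal Hx); rewrite -OT -eqCM normal_norm //.
  exact: gFnormal_trans.
have iM : #|H : M| = 4 by rewrite -divgS // H24 oM.
have [K isoK] := isog_subgroup_Sym sMH C1 iM.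
have -> : 'Sym_('I_4) = K :> {set _}.
  by apply/esym/eqP; rewrite eqEcard subsetT card_Sym card_ord -(card_isog isoK) H24.
exact: isoK.
Qed.
(* N_H(T x) = C_H(x) is a Sylow 2-subgroup Q of order 4; all three involutions of
   Q are conjugate to x, hence conjugate under N_H(Q), which thus has index 5. *)
Lemma torus_isog60 x : #|H| = 60 -> x \in H^# -> e x = 2 -> f x = 2 ->
    {in H^#, forall y, ~~ odd (e y) -> gval (T y) \in T x :^: H} ->
  H \isog 'Alt_('I_5).
Proof.
move=> H60 Hx e2 f2 conjT; have /setD1P[nx Hx'] := Hx; have sTH := T_sub Hx'.
have T2 t : t != 1%g -> forall A : {group hT}, t \in A -> #|A| = 2 -> A :=: [set 1%g; t].
  move=> nt A At A2; apply/esym/eqP; rewrite eqEcard subUset !sub1set group1 At A2.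
  by rewrite cards2 eq_sym nt.
have TxE : T x :=: [set 1%g; x] by apply: T2; rewrite ?T_id.
pose Q := ('N_H(T x))%G.
have sTQ : T x \subset Q by rewrite subsetI sTH normG.
have oQ : #|Q| = 4 by rewrite -(Lagrange sTQ) -/(e x) -/(f x) e2 f2.
have sQH : Q \subset H by apply: subsetIl.
have conjx y : y \in H -> ~~ odd #[y]%g -> exists2 g, g \in H & y = (x ^ g)%g.
  move=> Hy' ey; have ny : y != 1%g by apply: contraNneq ey => ->; rewrite order1.
  have Hy : y \in H^# by rewrite !inE ny.
  have ev : ~~ odd (e y).
    by apply: contra ey; apply: dvdn_odd; rewrite order_dvdG ?T_id.
  have /imsetP[g Hg Tg] := conjT y Hy ev; exists g => //.
  have : y \in [set 1%g; x] :^ g by rewrite -TxE -Tg T_id.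
  by case/imsetP=> z /set2P[->|->] // yE; rewrite yE conj1g eqxx in ny.
(* Since [T x] is {1, x}, normalising it means centralising [x]. *)
have CQ : 'C_H[x] = Q.
  apply/setP=> g; rewrite !in_setI; apply: andb_id2l => Hg.
  rewrite TxE; apply/cent1P/normP => [cxg | ].
    by rewrite conjUg !conjg_set1 conj1g /conjg -cxg mulKg.
  move/setP/(_ (x ^ g)%g); rewrite memJ_conjg !inE eqxx orbT conjg_eq1 (negPf nx) /=.
  by move/esym/eqP=> /conjg_fixP/commgP.
pose M := ('N_H(Q))%G.
have sMH : M \subset H by apply: subsetIl.
have sQM : Q \subset M by rewrite subsetI sQH normG.
have abQ : abelian Q by apply: (@card_p2group_abelian _ 2).
have CgQ g : g \in H -> 'C_H[x ^ g] = Q :^ g.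
  by move=> Hg; rewrite -CQ conjIg conjGid // cent1J.
have xM : x ^: M = Q^#.
  apply/eqP; rewrite eqEsubset class_sub_norm; last by rewrite normD1 subsetIr.
  rewrite in_setD1 nx (subsetP sTQ) ?T_id //=; apply/subsetP=> y /setD1P[ny Qy].
  have [|g Hg yE] := conjx y (subsetP sQH y Qy).
    have : #[y]%g %| 2 ^ 2 by rewrite -[2 ^ 2]oQ order_dvdG.
    case/dvdn_pfactor=> // -[|k] _ oy; last by rewrite oy oddX.
    by rewrite -order_eq1 oy in ny.
  (* [Q] is abelian, so it centralises [y = x ^ g] and equals ['C_H[x ^ g] = Q :^ g]: thus [g]
     normalises [Q]. *)
  rewrite yE imset_f // inE Hg; apply/normP/eqP; rewrite eq_sym eqEcard cardJg leqnn andbT.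
  by rewrite -CgQ // subsetI sQH sub_cent1 -yE (subsetP abQ).
have oM : #|M| = 12.
  have CM : 'C_M[x] = Q.
    by rewrite -[gval M](setIidPl sMH) -setIA CQ; apply/setIidPr.
  rewrite -(Lagrange (subsetIl M 'C[x])) [#|_ : _|](index_cent1 M x) xM /= CM [#|'N__(_)|]oQ.
  have q3 : #|Q^#| = 3 by apply: succn_inj; rewrite -[RHS]oQ (cardsD1 1%g Q) group1.
  by rewrite -[#|_^#|]/#|Q^#| q3.
pose C := gcore_group M H; have nC : C <| H by apply: gcore_normal.
have sCM : C \subset M by apply: gcore_sub.
have iM : #|H : M| = 5 by rewrite -divgS // H60 oM.
(* A core of even order contains an involution, hence all 15 conjugates of [x], too many for [M] of
   order 12. *)
have oddC : odd #|C|.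
  apply: contraT; rewrite -dvdn2 => /(Cauchy (isT : prime 2))[y Cy oy].
  have Hy : y \in H by apply: subsetP (subset_trans sCM sMH) y Cy.
  have [g Hg yE] := conjx y Hy ltac:(by rewrite oy).
  have sxC : x ^: H \subset C.
    have Cx : x \in C by rewrite -(memJ_norm x (subsetP (normal_norm nC) g Hg)) -yE.
    by rewrite class_sub_norm ?normal_norm.
  have := leq_trans (subset_leq_card sxC) (subset_leq_card sCM).
  by rewrite -index_cent1 CQ -divgS // H60 oQ oM.
have C1 : C :=: 1%g.
  have := cardSg sCM; rewrite oM dvdn_divisors // !inE.
  case/or4P=> [/eqP|/eqP|/eqP|/or3P[] /eqP] oC; try by rewrite oC in oddC.
    exact: card1_trivg.
  by have := normal_prime_torus nC; rewrite oC.
by apply: (isog_Alt sMH C1 iM); rewrite H60.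
Qed.

Theorem torus_partition_isog : H :!=: 1%g ->
  [\/ H \isog 'Alt_('I_4), H \isog 'Sym_('I_4) | H \isog 'Alt_('I_5)].
Proof.
case/torus_types=> [[H12 [x [Hx e3 _]]]|[H24 [x [Hx e3 f2]]]|[H60 [x [Hx e2 f2 conjT]]]].
- by constructor 1; apply: torus_isog12 e3.
- by constructor 2; apply: torus_isog24 f2.
- by constructor 3; apply: torus_isog60 conjT.
Qed.
End TorusPartition.

(** * Traceless 2 x 2 matrices *)

Import GRing.Theory Num.Theory.
Local Open Scope ring_scope.

Section TracelessMatrices.
Variable F : numFieldType.
Implicit Types A B C M N : 'M[F]_2.

Lemma mx2P A B :
  A 0 0 = B 0 0 -> A 0 1 = B 0 1 -> A 1 0 = B 1 0 -> A 1 1 = B 1 1 -> A = B.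
Proof.
move=> e00 e01 e10 e11; apply/matrixP=> i j.
have o2 (k : 'I_2) : k = 0 \/ k = 1.
  by case: k => [[|[|//]] ltk]; [left | right]; apply: val_inj.
by case: (o2 i) => ->; case: (o2 j) => ->.
Qed.

Lemma mulmx2E A B i j : (A *m B) i j = A i 0 * B 0 j + A i 1 * B 1 j.
Proof.
rewrite mxE !big_ord_recl big_ord0 addr0.
by congr (_ + A _ _ * B _ _); apply: val_inj.
Qed.

Lemma mxtrace2E A : \tr A = A 0 0 + A 1 1.
Proof.
by rewrite /mxtrace !big_ord_recl big_ord0 addr0; congr (_ + A _ _); apply: val_inj.
Qed.

Lemma tr0_11 M : \tr M = 0 -> M 1 1 = - M 0 0.
Proof. by rewrite mxtrace2E => /eqP; rewrite addrC addr_eq0 => /eqP. Qed.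

(** The entries of [M *m N - N *m M] are, up to sign and a factor 2, the 2 x 2 minors of the two
    coordinate vectors. *)
Lemma tr0_comm_prop M N : \tr M = 0 -> \tr N = 0 -> M != 0 ->
  M *m N = N *m M -> exists a, N = a *: M.
Proof.
move=> trM trN nzM MN.
have E i j : (M *m N) i j = (N *m M) i j by rewrite MN.
have M11 := tr0_11 trM; have N11 := tr0_11 trN.
have E00 := E 0 0; have E01 := E 0 1; have E10 := E 1 0.
rewrite !mulmx2E M11 N11 in E00 E01 E10; clear E MN.
have two0 : (2 : F) != 0 by rewrite pnatr_eq0.
have e01 : N 0 1 * M 0 0 = N 0 0 * M 0 1.
  apply: (mulfI two0); apply/eqP; rewrite -subr_eq0; apply/eqP.
  by rewrite -[RHS](subrr (N 0 0 * M 0 1 + N 0 1 * - M 0 0)) -{1}E01; ring.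
have e10 : N 1 0 * M 0 0 = N 0 0 * M 1 0.
  apply: (mulfI two0); apply/eqP; rewrite -subr_eq0; apply/eqP.
  by rewrite -[RHS](subrr (N 1 0 * M 0 0 + - N 0 0 * M 1 0)) -{2}E10; ring.
have e11 : N 1 0 * M 0 1 = N 0 1 * M 1 0.
  apply/eqP; rewrite -subr_eq0; apply/eqP.
  by rewrite -[RHS](subrr (N 0 0 * M 0 0 + N 0 1 * M 1 0)) -{1}E00; ring.
have sol (x y z : F) : y != 0 -> x * y = z -> x = z / y by move=> ny <-; rewrite mulfK.
have [p0|nzp] := eqVneq (M 0 0) 0; last first.
  by exists (N 0 0 / M 0 0); apply: mx2P; rewrite mxE ?M11 ?N11 mulrAC; apply: sol => //; ring.
have [q0|nzq] := eqVneq (M 0 1) 0; last first.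
  exists (N 0 1 / M 0 1); apply: mx2P; rewrite mxE ?M11 ?N11 mulrAC; apply: sol => //.
  - by rewrite mulrN mulNr e01.
have nzs : M 1 0 != 0.
  apply: contraNneq nzM => s0; apply/eqP; apply: mx2P; rewrite mxE // M11 p0 oppr0 //.
exists (N 1 0 / M 1 0); apply: mx2P; rewrite mxE ?M11 ?N11 mulrAC; apply: sol => //.
- by rewrite mulrN mulNr -e10.
Qed.

Lemma half_double (a : F) : (2^-1 * a) *+ 2 = a.
Proof. by rewrite -mulrnAl -[X in X * _]mulr_natr mulVf ?mul1r ?pnatr_eq0. Qed.

Definition traceless A := A - (2^-1 * \tr A)%:M.

Lemma traceless_tr A : \tr (traceless A) = 0.
Proof. by rewrite linearB /= mxtrace_scalar half_double subrr. Qed.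

Lemma tracelessE A : A = (2^-1 * \tr A)%:M + traceless A.
Proof. by rewrite addrC subrK. Qed.

Lemma traceless_eq0 A : (traceless A == 0) = is_scalar_mx A.
Proof.
rewrite subr_eq0; apply/eqP/is_scalar_mxP => [->|[a ->]]; first by exists (2^-1 * \tr A).
by rewrite mxtrace_scalar mulrnAr half_double.
Qed.

Lemma traceless_comm A B : traceless A *m B = B *m traceless A <-> A *m B = B *m A.
Proof.
by rewrite mulmxBl mulmxBr -scalar_mxC; split=> [/addIr | ->].
Qed.

(** The matrices commuting with [A] are combinations of 1 and [traceless A], hence commute with each
    other. *)
Lemma comm_mx_nonscalar A B C : ~~ is_scalar_mx A ->
  A *m B = B *m A -> A *m C = C *m A -> B *m C = C *m B.
Proof.
rewrite -traceless_eq0 => nzA.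
have red D : A *m D = D *m A -> exists a, traceless D = a *: traceless A.
  move=> AD; apply: tr0_comm_prop; rewrite ?traceless_tr //.
  exact/traceless_comm/esym/traceless_comm/esym.
move=> /red[b bE] /red[c cE]; rewrite (tracelessE B) (tracelessE C) bE cE.
rewrite !(mulmxDl, mulmxDr) !(mul_scalar_mx, mul_mx_scalar) -!scalemxAl -!scalemxAr.
by rewrite !scale_scalar_mx !scalerA addrACA (mulrC (2^-1 * \tr B) (2^-1 * _)) (mulrC b c).
Qed.

Lemma det_mx2 A : \det A = A 0 0 * A 1 1 - A 0 1 * A 1 0.
Proof.
rewrite (expand_det_row A 0) !big_ord_recl big_ord0 addr0 /cofactor !det_mx11 !mxE /=.
rewrite expr0 expr1 mul1r mulN1r mulrN.
by congr (_ * A _ _ - A _ _ * A _ _); apply: val_inj.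
Qed.

(** Cayley-Hamilton in trace zero. *)
Lemma tr0_sqr M : \tr M = 0 -> M *m M = (- \det M)%:M.
Proof.
by move=> trM; have M11 := tr0_11 trM; apply: mx2P;
   rewrite mulmx2E mxE det_mx2 ?M11 ?mulr1n ?mulr0n; ring.
Qed.

(* Otherwise M = traceless A is nilpotent and A = c + M with c <> 0, so that
   A^n = c^n + n c^(n-1) M is not scalar in characteristic 0. *)
Lemma finite_order_traceless A n :
  ~~ is_scalar_mx A -> A ^+ n.+1 = 1 -> \det (traceless A) != 0.
Proof.
rewrite -traceless_eq0 => nzM An1; apply/eqP => dM.
have trM := traceless_tr A; have AE := tracelessE A.
move: (traceless A) (2^-1 * \tr A) => M c in nzM dM trM AE.
have M2 : M *m M = 0 by rewrite tr0_sqr // dM oppr0 raddf0.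
have expA m : A ^+ m.+1 = (c ^+ m.+1)%:M + (m.+1%:R * c ^+ m) *: M.
  elim: m => [|m IH]; first by rewrite !expr1 expr0 mulr1 scale1r.
  rewrite exprSr IH [X in _ * X]AE -[_ * _]/(_ *m _).
  rewrite mulmxDl !mulmxDr -scalar_mxM -!scalemxAl M2 scaler0 addr0 -exprSr.
  rewrite !mul_scalar_mx mul_mx_scalar -addrA scalerA -scalerDl; congr (_ + _ *: _).
  by rewrite [m.+2%:R]mulrS exprSr; ring.
(* Traces give [c ^+ n.+1 = 1]; the remaining multiple of [M] must then vanish although its
   coefficient is nonzero. *)
have := An1; rewrite expA => E; have := congr1 mxtrace E.
rewrite mxtraceD mxtrace_scalar mxtraceZ trM mulr0 addr0 -[1]/(1%:M) mxtrace1.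
rewrite -(mulr_natl (c ^+ _)) -[RHS]mulr1 => /(mulfI _)  cn.
have {}cn : c ^+ n.+1 = 1 by apply: cn; rewrite pnatr_eq0.
have c0 : c != 0 by apply: contra_eq_neq cn => ->; rewrite expr0n eq_sym oner_eq0.
move: E; rewrite cn -[X in _ = X]addr0 => /addrI/eqP.
by rewrite scaler_eq0 (negPf nzM) orbF mulf_eq0 pnatr_eq0 /= expf_eq0 (negPf c0) andbF.
Qed.
End TracelessMatrices.

(** * Commutation up to sign *)

Section MatrixConj.
Variable F : numFieldType.
Implicit Types M X : 'M[F]_2.

(** Comparing determinants gives [a ^+ 2 = 1]. *)
Lemma line_sign M N a : \det M = \det N -> \det N != 0 ->
  M = a *: N -> M = N \/ M = - N.
Proof.
move=> eqd nzd E; have := eqd; rewrite E detZ -[RHS]mul1r => /(mulIf nzd)/eqP.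
by rewrite sqrf_eq1 => /orP[]/eqP->; rewrite ?scale1r ?scaleN1r; auto.
Qed.

Lemma anticomm_mul M X Y : M *m X = - (X *m M) -> M *m Y = - (Y *m M) ->
  M *m (X *m Y) = (X *m Y) *m M.
Proof. by move=> MX MY; rewrite mulmxA MX mulNmx -[X *m M *m Y]mulmxA MY mulmxN opprK mulmxA. Qed.
End MatrixConj.

(** * Stable lines of the adjoint representation *)

Section Adjoint.
Variables (F : numFieldType) (gT : finGroupType) (G : {group gT}).
Variable rho : mx_representation F G 2.
Implicit Types M N : 'M[F]_2.

Lemma Ad_actM g M N : g \in G ->
  Ad_act rho g (M *m N) = Ad_act rho g M *m Ad_act rho g N.
Proof. by move=> Gg; rewrite /Ad_act !mulmxA mulmxKV ?repr_mx_unit. Qed.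

Lemma Ad_act_line g M : g \in G ->
  Ad_act rho g M \in <[M]>%VS <-> exists a, rho g *m M = a *: (M *m rho g).
Proof.
move=> Gg; have uG := repr_mx_unit rho Gg; split=> [/vlineP[k Ek] | [k Ek]].
  by exists k; rewrite scalemxAl -Ek mulmxKV.
by apply/vlineP; exists k; rewrite /Ad_act Ek -scalemxAl mulmxK.
Qed.

(** The traceless matrices [delta_mx 0 1] and [delta_mx 1 0] cannot both lie on one line. *)
Lemma line_proper M : exists2 N, \tr N = 0 & N \notin <[M]>%VS.
Proof.
have trd (i j : 'I_2) : i != j -> \tr (delta_mx i j : 'M[F]_2) = 0.
  move=> nij; rewrite /mxtrace big1 // => k _; rewrite !mxE.
  by case: eqP => // ->; rewrite (negPf nij).
have [/vlineP[a Ea]|] := boolP (delta_mx 0 1 \in <[M]>%VS); last first.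
  by exists (delta_mx 0 1); rewrite ?trd.
have [/vlineP[b Eb]|] := boolP (delta_mx 1 0 \in <[M]>%VS); last first.
  by exists (delta_mx 1 0); rewrite ?trd.
have : (delta_mx 1 0 : 'M[F]_2) 1 0 * (delta_mx 0 1 : 'M[F]_2) 0 1
     = (delta_mx 1 0 : 'M[F]_2) 0 1 * (delta_mx 0 1 : 'M[F]_2) 1 0.
  by rewrite Ea Eb !mxE; ring.
by rewrite !mxE /= !mulr0 mulr1 => /eqP; rewrite oner_eq0.
Qed.

Lemma Ad_irr_lineP :
  mx_irreducible (Ad_repr rho) <->
  (forall M, \tr M = 0 -> M != 0 -> [exists g in G, Ad_act rho g M \notin <[M]>%VS]).
Proof.
split=> [/Ad_irrP irr M trM nzM | irr].
  apply: contraT; rewrite negb_exists_in => /forall_inP stM.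
  have [N trN nMN] := line_proper M; case/negP: (nMN).
  case: (irr <[M]>%VS) => [_ /vlineP[k ->] | g _ Gg /vlineP[k ->] | M0 | all].
  - by rewrite mxtraceZ trM mulr0.
  - by rewrite linearZ memvZ //; have := stM g Gg; rewrite negbK.
  - by case/eqP: nzM; apply/eqP; rewrite -memv0 -M0 memv_line.
  exact: all.
apply/Ad_irrP => W trW stW.
have [->|nzW] := eqVneq W 0%VS; [by left | right].
pose A := vpick W.
have nzA : A != 0 by rewrite vpick0.
have WA : A \in W by apply: memv_pick.
have /exists_inP[g Gg nAB] := irr A (trW _ WA) nzA.
set B := Ad_act rho g A in nAB.
have WB : B \in W by apply: stW.
clearbody B.
pose U := (<[A]> + <[B]>)%VS.
have sUW : (U <= W)%VS by rewrite subv_add -!memvE WA.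
have dU : (2 <= \dim U)%N.
  have := dimv_leqif_eq (addvSl <[A]> <[B]>); rewrite -/U dim_vline nzA => -[le1 eq1].
  rewrite ltn_neqAle le1 andbT eq1; apply: contra nAB => /eqP->.
  by rewrite memvE addvSr.
have nzC : A *m B - B *m A != 0.
  apply: contra nAB; rewrite subr_eq0 => /eqP AB.
  have [k ->] := tr0_comm_prop (trW _ WA) (trW _ WB) nzA AB.
  by rewrite memvZ ?memv_line.
have /exists_inP[h Gh] := irr (A *m B - B *m A) ltac:(by rewrite linearB /= mxtrace_mulC subrr) nzC.
(* [U] has dimension at least 2. Equality with [W] would make the commutator of [A] and [B] span a
   stable line; so [W] has dimension at least 3. *)
move=> nC; have stU : U != W.
  apply/eqP=> eqUW; case/negP: nC.
  have UW M : M \in W -> exists a b, M = a *: A + b *: B.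
    by rewrite -eqUW => /memv_addP[_ /vlineP[a ->] [_ /vlineP[b ->] ->]]; exists a, b.
  have [a [b Eab]] := UW _ (stW _ _ Gh WA); have [c [d Ecd]] := UW _ (stW _ _ Gh WB).
  (* The commutator is alternating, so [h] multiplies it by the determinant of its action on the
     plane. *)
  apply/vlineP; exists (a * d - b * c).
  rewrite linearB /= !Ad_actM // Eab Ecd.
  by apply: mx2P; rewrite !(mulmx2E, mxE); ring.
pose S := limg (linfun (@sl2_mx F)).
have dS : (\dim S <= 3)%N.
  have := limg_ker_dim (linfun (@sl2_mx F)) fullv; rewrite dimvf dim_matrix => d3.
  by rewrite -[X in (_ <= X)%N]d3 leq_addl.
have memS M : \tr M = 0 -> M \in S.
  by move=> trM; rewrite -(sl2_coordK trM) -(lfunE (@sl2_mx F)) memv_img ?memvf.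
have sWS : (W <= S)%VS by apply/subvP=> M /trW/memS.
have dW : (3 <= \dim W)%N.
  have [leUW eqUW] := dimv_leqif_eq sUW.
  by apply: leq_ltn_trans dU _; rewrite ltn_neqAle leUW eqUW stU.
have /eqP-> : W == S by rewrite eqEdim sWS (leq_trans dS).
by move=> M /memS.
Qed.

(** * Tori in the quotient by scalars *)

Let Z := rcenter_group rho.

Lemma rcentP A g : reflect (g \in G /\ A *m rho g = rho g *m A) (g \in rcent rho A).
Proof. by rewrite inE; apply: (iffP andP) => -[Gg /eqP]. Qed.

Lemma rcent_scale A c : c != 0 -> rcent rho (c *: A) = rcent rho A.
Proof.
move=> nzc; apply/setP=> g; rewrite !inE -scalemxAl -scalemxAr.
by rewrite (inj_eq (scalerI nzc)).
Qed.

Lemma rcent_nonscalar g h : ~~ is_scalar_mx (rho g) -> ~~ is_scalar_mx (rho h) ->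
  h \in rcent rho (rho g) -> rcent rho (rho h) = rcent rho (rho g).
Proof.
move=> nsg nsh /rcentP[Gh gh]; apply/setP=> k; apply/rcentP/rcentP=> -[Gk] E; split=> //.
  exact: comm_mx_nonscalar nsh _ E.
exact: comm_mx_nonscalar nsg gh E.
Qed.

Lemma rcenter_sub_rcent A : Z \subset rcent rho A.
Proof.
by apply/subsetP=> z; rewrite !inE => /andP[-> /is_scalar_mxP[c ->]]; rewrite scalar_mxC eqxx.
Qed.

Lemma rcent_conj g h : g \in G -> h \in G ->
  rcent rho (rho (g ^ h)%g) = (rcent rho (rho g) :^ h)%g.
Proof.
move=> Gg Gh; apply/setP=> k; rewrite mem_conjg !inE groupJr ?groupV //.
have [Gk|//] := boolP (k \in G); rewrite /=.
rewrite -[k in LHS](conjgKV h); move: (k ^ h^-1)%g (groupJ Gk (groupVr Gh)) => l Gl.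
rewrite -!repr_mxM ?groupJ // -!conjMg /conjg !repr_mxM ?(groupM, groupV) //.
rewrite !repr_mxV ?groupM //.
have uh := repr_mx_unit rho Gh.
by rewrite (inj_eq (can_inj (mulKVmx uh))) (inj_eq (can_inj (mulmxK uh))).
Qed.

(** The traceless part of [rho (g ^ h)] is the conjugate of [M] by [rho h]. Commuting with [rho g]
    makes it proportional to [M], with factor 1 or -1 by [line_sign]. *)
Lemma rcent_sign g : g \in G -> ~~ is_scalar_mx (rho g) ->
  let M := traceless (rho g) in
  {in G, forall h, (g ^ h)%g \in rcent rho (rho g) ->
     h \in rcent rho (rho g) \/ M *m rho h = - (rho h *m M)}.
Proof.
move=> Gg nsg M h Gh /rcentP[Gh' cgh]; have uh := repr_mx_unit rho Gh.
have trM : \tr M = 0 by apply: traceless_tr.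
have nzM : M != 0 by rewrite traceless_eq0.
have dM : \det M != 0.
  apply: (@finite_order_traceless _ _ #[g]%g.-1 nsg).
  by rewrite prednK ?order_gt0 // -repr_mxX // expg_order repr_mx1.
pose N := invmx (rho h) *m M *m rho h.
have trN : \tr N = 0 by rewrite mxtrace_mulC mulKVmx.
have defN : N = traceless (rho (g ^ h)%g).
  rewrite /traceless /conjg !repr_mxM ?(groupM, groupV) // repr_mxV //.
  rewrite [in \tr _]mulmxA mxtrace_mulC mulKVmx // /N /M mulmxBr mulmxBl scalar_mxC.
  by rewrite -(mulmxA _ (invmx _)) mulVmx // mulmx1 mulmxA.
have [|a Ea] := tr0_comm_prop trM trN nzM.
  by rewrite defN; apply/traceless_comm/esym/traceless_comm/esym.
have MX : M *m rho h = a *: (rho h *m M).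
  by rewrite scalemxAr -Ea /N -mulmxA mulKVmx.
have [||E|E] := line_sign _ _ MX; rewrite ?det_mulmx; [exact: mulrC| |left|by right].
  by rewrite mulf_neq0 // -unitfE -unitmxE.
by apply/rcentP; split=> //; apply/traceless_comm.
Qed.

(* [rcent] does not depend on the representative, which may only vary by scalars;
   see [torus_coset]. *)
Definition torus (x : coset_of Z) : {group coset_of Z} :=
  (rcent_group rho (rho (repr x)) / Z)%G.

Let nZ g : g \in G -> g \in 'N(Z)%g.
Proof. exact/subsetP/normal_norm/rcenter_normal. Qed.

Lemma coset_rcenterJ g h : g \in G -> h \in G ->
  coset Z (g ^ h)%g = (coset Z g ^ coset Z h)%g.
Proof. by move=> Gg Gh; rewrite morphJ ?nZ. Qed.

Lemma coset_rcenterM g h : g \in G -> h \in G ->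
  coset Z (g * h)%g = (coset Z g * coset Z h)%g.
Proof. by move=> Gg Gh; rewrite morphM ?nZ. Qed.

Lemma torus_coset g : g \in G -> torus (coset Z g) = (rcent_group rho (rho g) / Z)%G.
Proof.
move=> Gg; apply: val_inj; rewrite /=.
have: repr (coset Z g) \in (Z :* g)%g by rewrite -val_coset ?nZ // mem_repr_coset.
case/rcosetP=> z Zz ->; have Gz : z \in G by move: Zz; rewrite inE => /andP[].
rewrite repr_mxM //; have /is_scalar_mxP[c zE] : is_scalar_mx (rho z).
  by move: Zz; rewrite inE => /andP[].
rewrite zE mul_scalar_mx rcent_scale //.
have := repr_mx_unit rho Gz; rewrite zE unitmxE det_scalar unitfE.
by apply: contraNneq => ->; rewrite expr0n.
Qed.

(** The centraliser contains [Z], so membership modulo [Z] can be tested in [G]. *)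
Lemma mem_torus g h : g \in G -> h \in G ->
  (coset Z h \in torus (coset Z g)) = (h \in rcent rho (rho g)).
Proof.
move=> Gg Gh; rewrite torus_coset //; apply/idP/idP=> [|Ch]; last exact: mem_quotient.
case/morphimP=> k Nk Ck /rcoset_kercosetP; rewrite nZ // => /(_ isT Nk)/rcosetP[z Zz ->].
by rewrite groupM // (subsetP (rcenter_sub_rcent _)).
Qed.

Lemma quotient_rep x : x \in (G / Z)%g -> exists2 g, g \in G & x = coset Z g.
Proof. by case/morphimP=> g _ Gg ->; exists g. Qed.

Lemma coset_nonscalar g : g \in G -> (coset Z g != 1%g) = ~~ is_scalar_mx (rho g).
Proof.
move=> Gg; congr (~~ _); have -> : is_scalar_mx (rho g) = (g \in Z) by rewrite inE Gg.
by apply/eqP/idP => [/coset_idr|/coset_id] // ->; rewrite ?nZ.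
Qed.

(** Normalising elements outside the torus anticommute with [traceless (rho g)], so the product of
    two of them commutes with it. *)
Lemma torus_index_le2 g : g \in G -> ~~ is_scalar_mx (rho g) ->
  (#|'N_(G / Z)(torus (coset Z g)) : torus (coset Z g)|%g <= 2)%N.
Proof.
move=> Gg nsg; set T := torus _.
have norm_sign h : h \in G -> coset Z h \in 'N(T)%g -> coset Z h \notin T ->
    traceless (rho g) *m rho h = - (rho h *m traceless (rho g)).
  move=> Gh Nh; rewrite mem_torus // => nCh.
  have : (coset Z g ^ coset Z h)%g \in T by rewrite memJ_norm // mem_torus //; apply/rcentP.
  rewrite -coset_rcenterJ // (mem_torus Gg (groupJ Gg Gh)) => /(rcent_sign Gg nsg Gh)[] // Ch.
  by rewrite Ch in nCh.
apply: (@index_le2 _ T ('N_(G / Z)(T))%G) => [|a b].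
  by rewrite subsetI normG andbT /T torus_coset // quotientS //; apply/subsetP=> h /rcentP[].
case/setIP=> /quotient_rep[h Gh ->] Nh /setIP[/quotient_rep[k Gk ->] Nk] nTh nTk.
rewrite -coset_rcenterM // (mem_torus Gg (groupM Gh Gk)); apply/rcentP; split; first exact: groupM.
by apply/traceless_comm; rewrite repr_mxM //; apply: anticomm_mul; apply: norm_sign.
Qed.

Lemma torus_nonnormal g : mx_irreducible (Ad_repr rho) -> g \in G ->
  ~~ is_scalar_mx (rho g) -> ~~ (G / Z \subset 'N(torus (coset Z g)))%g.
Proof.
move=> /Ad_irr_lineP irr Gg nsg; apply/negP=> sGN; set M := traceless (rho g).
have nzM : M != 0 by rewrite traceless_eq0.
have /exists_inP[h Gh /negP[]] := irr M (traceless_tr _) nzM.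
have Nh : coset Z h \in 'N(torus (coset Z g))%g by rewrite (subsetP sGN) ?mem_quotient.
have : (coset Z g ^ coset Z h)%g \in torus (coset Z g).
  by rewrite memJ_norm // mem_torus //; apply/rcentP.
rewrite -coset_rcenterJ // (mem_torus Gg (groupJ Gg Gh)).
case/(rcent_sign Gg nsg Gh)=> [/rcentP[_ /traceless_comm E] | E].
  by apply/Ad_act_line => //; exists 1; rewrite scale1r.
by apply/Ad_act_line => //; exists (-1); rewrite E scaleN1r opprK.
Qed.

(** If all of [G] acted by scalars, [Ad_act] would be trivial and every line stable. *)
Lemma Ad_irr_quotient_neq1 : mx_irreducible (Ad_repr rho) -> (G / Z != 1)%g.
Proof.
move=> /Ad_irr_lineP irr; have [N trN nN] := line_proper 0.
have nzN : N != 0 by apply: contraNneq nN => ->; apply: mem0v.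
have /exists_inP[h Gh nNh] := irr N trN nzN.
apply: contraNneq nNh => G1.
have /set1P/eqP : coset Z h \in [1 coset_of Z]%g by rewrite -G1 mem_quotient.
rewrite -[_ == _]negbK coset_nonscalar // negbK => /is_scalar_mxP[c E].
by apply/Ad_act_line => //; exists 1; rewrite scale1r E scalar_mxC.
Qed.

Lemma Ad_irr_isog : mx_irreducible (Ad_repr rho) ->
  [\/ (G / Z \isog 'Alt_('I_4))%g, (G / Z \isog 'Sym_('I_4))%g | (G / Z \isog 'Alt_('I_5))%g].
Proof.
move=> irr; apply: (@torus_partition_isog _ (G / Z)%G torus); last exact: Ad_irr_quotient_neq1.
- move=> x /quotient_rep[g Gg ->]; rewrite torus_coset // quotientS //.
  by apply/subsetP=> h /rcentP[].
- by move=> x /quotient_rep[g Gg ->]; rewrite mem_torus //; apply/rcentP.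
- move=> x /setD1P[nx /quotient_rep[g Gg xE]] y; rewrite {}xE in nx *.
  rewrite [in X in X -> _]torus_coset // => /morphimP[h Nh Ch ->] ny.
  have /rcentP[Gh _] := Ch; rewrite coset_nonscalar // in nx; rewrite coset_nonscalar // in ny.
  by rewrite !torus_coset //; apply: val_inj; rewrite /= (rcent_nonscalar nx ny Ch).
- move=> _ _ /quotient_rep[g Gg ->] /quotient_rep[h Gh ->].
  rewrite -coset_rcenterJ // !torus_coset ?groupJ //; apply: val_inj; rewrite /= rcent_conj //.
  by rewrite quotientJ // nZ.
- move=> x /setD1P[nx /quotient_rep[g Gg xE]]; rewrite {}xE coset_nonscalar // in nx *.
  exact: torus_index_le2.
move=> x /setD1P[nx /quotient_rep[g Gg xE]]; rewrite {}xE coset_nonscalar // in nx *.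
exact: torus_nonnormal.
Qed.
End Adjoint.

(** * The projective image *)

Section ProjectiveImage.
Variables (F : numFieldType) (gT : finGroupType) (G : {group gT}).
Variable rho : mx_representation F G 2.
Let Z := rcenter_group rho.

Lemma repr_GLM g h : g \in G -> h \in G ->
  repr_GL rho (g * h)%g = (repr_GL rho g * repr_GL rho h)%g.
Proof.
by move=> Gg Gh; apply: val_inj; rewrite val_GLM !val_repr_GL ?groupM // repr_mxM.
Qed.

(** [Z] is the kernel of the map from [G] to [PGL F 2]. *)
Lemma to_PGL_repr_eq g h : g \in G -> h \in G ->
  (to_PGL (repr_GL rho g) == to_PGL (repr_GL rho h)) = (g * h^-1 \in Z)%g.
Proof.
move=> Gg Gh; have uh := repr_mx_unit rho Gh.
rewrite inE groupM ?groupV //= repr_mxM ?groupV // repr_mxV //.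
apply/eqP/is_scalar_mxP => [/to_PGL_eq[c _] | [c]].
  by rewrite !val_repr_GL // => ->; exists c; rewrite -scalemxAl mulmxV // scalemx1.
move=> Ec; apply/to_PGL_eq; rewrite !val_repr_GL //.
have E : rho g = c *: rho h by rewrite -mul_scalar_mx -Ec mulmxKV.
exists c => //; apply: contraTneq (repr_mx_unit rho Gg) => c0.
by rewrite E c0 scale0r unitmxE det0 unitr0.
Qed.

Lemma isomorphic_to_proj_image (aT : finGroupType) (A : {group aT}) :
  (G / Z \isog A)%g -> isomorphic_to A (proj_image rho).
Proof.
rewrite isog_sym => /isogP[f /injmP injf fA].
have frep x : x \in A -> exists2 g, g \in G & f x = coset Z g.
  by move=> Ax; apply: quotient_rep; rewrite -fA mem_morphim.
pose lift (x : coset_of Z) := to_PGL (repr_GL rho (repr x)).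
have liftE g : g \in G -> lift (coset Z g) = to_PGL (repr_GL rho g).
  move=> Gg; apply/eqP.
  have : repr (coset Z g) \in (Z :* g)%g.
    by rewrite -val_coset ?mem_repr_coset // (subsetP (normal_norm (rcenter_normal rho))).
  case/rcosetP=> z Zz zE; have Gz : z \in G by move: Zz; rewrite inE => /andP[].
  by rewrite /lift zE (to_PGL_repr_eq (groupM Gz Gg) Gg) mulgK.
exists (fun x => lift (f x)); split.
- move=> x y Ax Ay; have [g Gg xE] := frep x Ax; have [h Gh yE] := frep y Ay.
  by rewrite morphM // xE yE -coset_rcenterM // !liftE ?groupM // repr_GLM // to_PGLM.
- move=> x y Ax Ay; have [g Gg xE] := frep x Ax; have [h Gh yE] := frep y Ay.
  rewrite xE yE !liftE // => /eqP; rewrite to_PGL_repr_eq // => Zgh.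
  apply: injf => //; rewrite xE yE; apply/rcoset_kercosetP.
  - by rewrite (subsetP (normal_norm (rcenter_normal rho))).
  - by rewrite (subsetP (normal_norm (rcenter_normal rho))).
  by rewrite mem_rcoset.
move=> y; rewrite inE; split=> [/exists_inP[g Gg /eqP->] | [x Ax ->]].
  have : coset Z g \in (f @* A)%g by rewrite fA mem_quotient.
  by case/morphimP=> x _ Ax Ex; exists x; rewrite // -Ex liftE.
have [g Gg ->] := frep x Ax; apply/exists_inP; exists g => //.
by rewrite liftE.
Qed.

(** As in Schur's lemma: the left kernel of [M] is a submodule, and it is not everything because [M]
    is nonzero. *)
Lemma irr_det_neq0 (M : 'M[F]_2) : mx_irreducible rho -> M != 0 ->
  (forall g, g \in G -> exists a, rho g *m M = a *: (M *m rho g)) -> \det M != 0.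
Proof.
move=> /mx_irrP[_ irr] nzM stM; apply: contraNneq nzM => dM0.
have modK : mxmodule rho (kermx M).
  apply/mxmoduleP=> g Gg; apply/sub_kermxP; have [c E] := stM g Gg.
  by rewrite -mulmxA E -scalemxAr mulmxA mulmx_ker mul0mx scaler0.
have nzK : kermx M != 0 by rewrite kermx_eq0 row_free_unit unitmxE dM0 unitr0.
by have := irr _ modK nzK; rewrite -sub1mx => /sub_kermxP; rewrite mul1mx => ->.
Qed.

Lemma isomorphic_to_Ad_irr (aT : finGroupType) (A : {group aT}) (a b : aT) :
  mx_irreducible rho -> isomorphic_to A (proj_image rho) -> a \in A -> b \in A ->
  (a ^+ 2 * b ^+ 2 != b ^+ 2 * a ^+ 2)%g -> mx_irreducible (Ad_repr rho).
Proof.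
move=> irr [f [fM injf fA]] Aa Ab nab.
apply/Ad_irr_lineP=> M trM nzM; apply: contraT; rewrite negb_exists_in => /forall_inP stM.
have {}stM g : g \in G -> exists c, rho g *m M = c *: (M *m rho g).
  by move=> Gg; apply/Ad_act_line => //; have := stM g Gg; rewrite negbK.
have dM := irr_det_neq0 irr nzM stM.
(* [rho g] commutes or anticommutes with [M]; the sign cancels in the square. *)
have sqM g : g \in G -> M *m rho (g ^+ 2)%g = rho (g ^+ 2)%g *m M.
  move=> Gg; have [c Ec] := stM g Gg; rewrite !expgS expg0 mulg1 repr_mxM //.
  have [||E|E] := line_sign _ _ Ec; rewrite ?det_mulmx; [exact: mulrC| | |].
  - by rewrite mulf_neq0 // -unitfE -unitmxE repr_mx_unit.
  - by rewrite mulmxA -E -!mulmxA E.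
  by apply: anticomm_mul; rewrite E opprK.
have nsM : ~~ is_scalar_mx M.
  apply: contra nzM => /is_scalar_mxP[c E]; move: trM; rewrite E mxtrace_scalar => /eqP.
  by rewrite -mulr_natr mulf_eq0 pnatr_eq0 orbF => /eqP->; rewrite raddf0.
have frep x : x \in A -> exists2 g, g \in G & f x = to_PGL (repr_GL rho g).
  move=> Ax; have : f x \in proj_image rho by apply/fA; exists x.
  by rewrite inE => /exists_inP[g Gg /eqP]; exists g.
have [g Gg Eg] := frep a Aa; have [h Gh Eh] := frep b Ab.
case/eqP: nab; apply: injf; rewrite ?groupM ?groupX //.
rewrite (fM _ _ (groupX 2 Aa) (groupX 2 Ab)) (fM _ _ (groupX 2 Ab) (groupX 2 Aa)).
have f2 x k : x \in A -> k \in G -> f x = to_PGL (repr_GL rho k) ->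
    f (x ^+ 2)%g = to_PGL (repr_GL rho (k ^+ 2)%g).
  by move=> Ax Gk E; rewrite !expgS !expg0 !mulg1 fM // E -to_PGLM repr_GLM.
rewrite (f2 _ _ Aa Gg Eg) (f2 _ _ Ab Gh Eh) -!to_PGLM; congr to_PGL.
apply: val_inj; rewrite !val_GLM !val_repr_GL ?groupX //.
by apply: (comm_mx_nonscalar nsM); apply: sqM.
Qed.
End ProjectiveImage.

Theorem proposition3p1 (R : realType) (gT : finGroupType) (G : {group gT})
    (rho : mx_representation (complex R) G 2) (irr_rho : mx_irreducible rho) :
  mx_irreducible (Ad_repr rho) <->
  (isomorphic_to (Alt 'I_4) (proj_image rho) \/
   isomorphic_to (Sym 'I_4) (proj_image rho) \/
   isomorphic_to (Alt 'I_5) (proj_image rho)).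
Proof.
split=> [/Ad_irr_isog[]|].
- by move/isomorphic_to_proj_image; left.
- by move/isomorphic_to_proj_image; right; left.
- by move/isomorphic_to_proj_image; right; right.
have alt n : exists a b, [/\ a \in Alt 'I_n.+4, b \in Alt 'I_n.+4 &
      (a ^+ 2 * b ^+ 2 != b ^+ 2 * a ^+ 2)%g].
  pose u := @inord n.+3.
  have uE i : (i < 4)%N -> u i = i :> nat.
    by move=> lti; rewrite inordK // (leq_trans lti).
  have uniq_u : uniq [:: u 0%N; u 1%N; u 2%N; u 3%N] by rewrite /= !inE -!val_eqE /= !uE.
  have [Aa Ab nab] := noncommuting_squares uniq_u.
  by do 2!eexists; split; [exact: Aa | exact: Ab | exact: nab].
case=> [iso|[iso|iso]].
- have [a [b [Aa Ab nab]]] := alt 0%N; exact: isomorphic_to_Ad_irr iso Aa Ab nab.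
(* The even permutations found for four letters also serve in the full symmetric group. *)
- have [a [b [_ _ nab]]] := alt 0%N.
  by apply: (@isomorphic_to_Ad_irr _ _ _ rho _ (Sym_group 'I_4) a b) iso _ _ nab; rewrite ?inE.
have [a [b [Aa Ab nab]]] := alt 1%N; exact: isomorphic_to_Ad_irr iso Aa Ab nab.
Qed.
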